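(* Let $\mathbf p,\tilde{\mathbf p}$ be nil-polynomials associated to the admissible algebras $\mathcal N,\tilde{\mathcal N}$ respectively. Then: (i) $\mathcal N,\tilde{\mathcal N}$ are isomorphic if and only if $\mathbf p,\tilde{\mathbf p}$ are affinely equivalent. (ii) In case $\mathcal N$ has Property (AH) (for instance, if $\mathcal N$ admits a grading), (i) remains true with ''affinely'' replaced by ''linearly'', i.e. $\mathcal N,\tilde{\mathcal N}$ are isomorphic if and only if $\mathbf p,\tilde{\mathbf p}$ are linearly equivalent.
   Context: $\mathbb F$ is a field of characteristic $0$; all algebras are associative $\mathbb F$-algebras. An admissible algebra is a commutative nilpotent algebra $\mathcal N$ of finite dimension over $\mathbb F$ whose annihilator $\mathcal N_{[1]}=\{x\in\mathcal N:x\mathcal N=0\}$ has dimension $1$. A pointing on $\mathcal N$ is a linear form $\omega:\mathcal N\to\mathbb F$ with $\omega(\mathcal N_{[1]})=\mathbb F$. For a finite-dimensional vector space $W$ (possibly $0$), $\mathbf p\in\mathbb F[W]$ is a nil-polynomial associated to $\mathcal N$ if there are a pointing $\omega$ on $\mathcal N$ and a linear isomorphism $\phi:W\to\ker(\omega)$ with $\mathbf p=\omega\circ\exp_2\circ\phi$, where $\exp_2(x)=\sum_{k\ge2}x^k/k!$. Its graph is $\Gamma_{\mathbf p}=\{(x,t)\in W\oplus\mathbb F:t=\mathbf p(x)\}$. Nil-polynomials $\mathbf p\in\mathbb F[W]$, $\tilde{\mathbf p}\in\mathbb F[\tilde W]$ are linearly (affinely) equivalent if there exists a linear (affine) isomorphism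 $W\oplus\mathbb F\to\tilde W\oplus\mathbb F$ mapping $\Gamma_{\mathbf p}$ onto $\Gamma_{\tilde{\mathbf p}}$. $\mathcal N$ has Property (AH) if for some (equivalently, every) nil-polynomial $\mathbf p$ associated to $\mathcal N$ the graph $\Gamma_{\mathbf p}$ is affinely homogeneous, i.e. the group of affine bijections of $W\oplus\mathbb F$ stabilizing $\Gamma_{\mathbf p}$ acts transitively on $\Gamma_{\mathbf p}$. A grading of $\mathcal N$ is a vector space decomposition $\mathcal N=\bigoplus_{k\in\mathbb Z^+}\mathcal N_k$ over the positive integers with $\mathcal N_j\mathcal N_k\subset\mathcal N_{j+k}$ for all $j,k$. *)

(* Defs.v *)
From HB Require Import structures.
From mathcomp Require Import all_boot all_order all_algebra.
From mathcomp Require Import classical_sets.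

Set Implicit Arguments.
Unset Strict Implicit.
Unset Printing Implicit Defensive.

Import GRing.Theory.
Local Open Scope ring_scope.

(* Not assumed unital or commutative.  The bilinear product is curried, as the
   linear map x |-> (y |-> x y). *)
Record assocAlgebra (F : fieldType) := AssocAlgebra {
  alg_sort :> vectType F;
  alg_mul : 'Hom(alg_sort, 'End(alg_sort));
  alg_mulA : associative (fun x y => alg_mul x y)
}.

Definition amul (F : fieldType) (N : assocAlgebra F) (x y : N) : N :=
  alg_mul N x y.

Section AlgebraNotions.
Variables (F : fieldType) (N : assocAlgebra F).

Definition commutative_alg : Prop := commutative (@amul F N).

(* All products of n.+1 elements vanish, for some n. *)
Definition nilpotent_alg : Prop :=
  exists n : nat, forall (x : N) (s : n.-tuple N), foldl (@amul F N) x s = 0.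

Definition annihilator : {vspace N} := lker (alg_mul N).

Lemma annihilatorP (x : N) :
  reflect (forall y : N, amul x y = 0) (x \in annihilator).
Proof.
rewrite memv_ker; apply: (iffP eqP) => [x0 y | x0].
  by rewrite /amul x0 lfunE.
by apply/lfunP => y; rewrite lfunE; apply: x0.
Qed.

Definition admissible : Prop :=
  [/\ commutative_alg, nilpotent_alg & \dim annihilator = 1%N].

(* x^k for k >= 1; there is no unit, and the value at k = 0 is never used. *)
Definition apow (x : N) (k : nat) : N := iter k.-1 (amul x) x.

(* The series is cut at k = \dim N: in a nilpotent algebra all higher powers
   vanish (apow_gt_dim, exp2_widen). *)
Definition exp2 (x : N) : N :=
  \sum_(2 <= k < (\dim {:N}).+1) (k`!%:R : F)^-1 *: apow x k.

Lemma apow_gt_dim (x : N) (k : nat) :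
  nilpotent_alg -> (\dim {:N} < k)%N -> apow x k = 0.
Proof.
move=> [n nilN] ltNk; pose L := alg_mul N x.
have mulA : associative (@amul F N) := @alg_mulA F N.
have foldlE m (y z : N) : foldl (@amul F N) (amul y z) (nseq m x)
    = amul y (foldl (@amul F N) z (nseq m x)).
  by elim: m z => //= m IHm z; rewrite -mulA IHm.
have powE m : iter m (amul x) x = foldl (@amul F N) x (nseq m x).
  by elim: m => //= m IHm; rewrite foldlE -IHm.
have pow0 : iter n (amul x) x = 0 by rewrite powE; apply: nilN (nseq_tuple n x).
have iterE m (y : N) : iter m.+1 (amul x) y = amul (iter m (amul x) x) y.
  by elim: m => // m IHm; rewrite iterS IHm /= mulA.
pose U m := iter m (fun V => L @: V)%VS fullv.
have memU m y : iter m (amul x) y \in U m.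
  by elim: m => [|m IHm]; rewrite ?memvf //=; apply: memv_img.
have subU m : (U m.+1 <= U m)%VS.
  by elim: m => [|m IHm]; [apply: subvf | apply: limgS].
have U0 : U n.+1 = 0%VS.
  apply/eqP; rewrite -subv0; apply/subvP => z.
  have: exists y, z \in U n.+1 -> z = iter n.+1 (amul x) y.
    elim: n.+1 z => [|m IHm] z; first by exists z.
    case: (boolP (z \in U m.+1)) => [/memv_imgP[u uU ->] | _]; last by exists 0.
    by have [y ->//] := IHm u; exists y.
  by case=> y zE /zE ->; rewrite iterE pow0 /amul linear0 lfunE mem0v.
have dimU m : (m + \dim (U m) <= \dim {:N})%N \/ U m = 0%VS.
  elim: m => [|m [IHm | Um0]]; [by left | | by right; rewrite /= Um0 limg0].
  have [ltU | leU] := ltnP (\dim (U m.+1)) (\dim (U m)).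
    by left; rewrite (leq_trans _ IHm) // addSnnS leq_add2l.
  have eqU : U m.+1 = U m by apply/eqP; rewrite eqEdim subU leU.
  have stab j : U (j + m)%N = U m.
    by elim: j => // j IHj; rewrite addSn -[RHS]eqU /= -/(U _) IHj.
  right; rewrite eqU -(stab n.+1) addnC; elim: m {IHm leU eqU stab} => [|m IHm].
    by rewrite add0n U0.
  by rewrite addSn /= -/(U _) IHm limg0.
case: k ltNk => // k; rewrite ltnS => leNk.
have Uk0 : U k = 0%VS.
  case: (dimU k) => // leUk; apply/eqP; rewrite -dimv_eq0 -leqn0.
  by rewrite -(leq_add2l k) addn0 (leq_trans leUk).
by apply/eqP; rewrite -memv0 -Uk0; apply: memU.
Qed.

Lemma exp2_widen (x : N) (m : nat) :
  nilpotent_alg -> (\dim {:N} < m)%N ->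
  \sum_(2 <= k < m) (k`!%:R : F)^-1 *: apow x k = exp2 x.
Proof.
move=> nilN ltNm; rewrite /exp2.
have [le2N | ltN2] := leqP 2 (\dim {:N}).+1.
  rewrite (big_cat_nat le2N ltNm) /= [X in _ + X]big_nat_cond.
  rewrite [X in _ + X]big1 ?addr0 // => k /andP[/andP[ltNk _] _].
  by rewrite apow_gt_dim ?scaler0.
rewrite [RHS]big_geq ?(ltnW ltN2) // big_nat_cond big1 // => k.
case/andP=> /andP[le2k _] _; rewrite apow_gt_dim ?scaler0 //.
exact: leq_trans (ltn_trans (ltnSn _) ltN2) le2k.
Qed.

Definition pointing (omega : 'Hom(N, F^o)) : Prop :=
  (omega @: annihilator)%VS = fullv.

(* Elements of F[W] are represented by the polynomial functions they induce,
   which is faithful because F will be of characteristic 0, hence infinite. *)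
Definition nil_polynomial (W : vectType F) (p : W -> F) : Prop :=
  exists omega : 'Hom(N, F^o), pointing omega /\
  exists phi : 'Hom(W, subvs_of (lker omega)),
    bijective phi /\ forall x : W, p x = omega (exp2 (vsval (phi x))).

(* The value of the family at 0 is irrelevant to a grading by the positive
   integers and is normalized to 0; finite dimension allows only finitely many
   nonzero components. *)
Definition is_grading (G : nat -> {vspace N}) : Prop :=
  [/\ G 0%N = 0%VS,
      exists m : nat, [/\ forall k, (m <= k)%N -> G k = 0%VS,
                          directv (\sum_(k < m) G k)
                        & (\sum_(k < m) G k)%VS = fullv]
    & forall (j k : nat) (x y : N),
        x \in G j -> y \in G k -> amul x y \in G (j + k)%N].

Definition has_grading : Prop := exists G, is_grading G.

End AlgebraNotions.

Definition isomorphic_alg (F : fieldType) (N N' : assocAlgebra F) : Prop :=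
  exists f : 'Hom(N, N'),
    bijective f /\ forall x y : N, f (amul x y) = amul (f x) (f y).

Section Graphs.
Variable F : fieldType.
Local Open Scope classical_set_scope.

Definition graph (W : vectType F) (p : W -> F) : set (W * F^o)%type :=
  [set z | z.2 = p z.1].

Definition affine_iso (U V : vectType F) (g : U -> V) : Prop :=
  exists (A : 'Hom(U, V)) (c : V), bijective A /\ forall z, g z = A z + c.

Definition linearly_equivalent (W W' : vectType F)
    (p : W -> F) (p' : W' -> F) : Prop :=
  exists f : 'Hom((W * F^o)%type, (W' * F^o)%type),
    bijective f /\ f @` graph p = graph p'.

Definition affinely_equivalent (W W' : vectType F)
    (p : W -> F) (p' : W' -> F) : Prop :=
  exists g : (W * F^o)%type -> (W' * F^o)%type,
    affine_iso g /\ g @` graph p = graph p'.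

Definition affinely_homogeneous (U : vectType F) (S : set U) : Prop :=
  forall x y, S x -> S y ->
    exists g : U -> U, [/\ affine_iso g, g @` S = S & g x = y].

Definition propertyAH (N : assocAlgebra F) : Prop :=
  exists (W : vectType F) (p : W -> F),
    nil_polynomial N p /\ affinely_homogeneous (graph p).

End Graphs.

(* Main.v *)
Require Import Defs.
From HB Require Import structures.
From mathcomp Require Import all_boot all_order all_algebra.
From mathcomp Require Import classical_sets ring.

(* For a pointing w with kernel K and a in the annihilator with w a = 1, the map
   (x, t) |-> x - t a identifies the graph of w o exp_2 on K with the
   hypersurface S_w = {z | w (exp z - 1) = 0} of N.

   Isomorphic implies affinely equivalent: by nondegeneracy of the form w (x y)
   on N / annihilator, any other pointing with the same value at a has the form
   x |-> w (exp v x) with w (exp v - 1) = 0, and its hypersurface is the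
   translate S_w - v.

   Affinely equivalent implies isomorphic: translating as above, one may assume
   that a linear bijection f maps S_w into S_w'.  Comparing the coefficients of
   s, s^2, s^3 along the curves s x - w (exp (s x) - 1) a shows that f induces a
   linear bijection psi : N -> N' with w' (psi x psi y) = c w (x y) and
   w' (psi x psi y psi z) = c w (x y z) up to terms of the form
   w (x y) w' (psi z (f a)).  The operators of multiplication by x in N and by
   psi x in N' are nilpotent, so their traces vanish, which kills these terms;
   then psi is multiplicative by nondegeneracy.

   Gradings: multiplying each component N_k by (1 - y)^k is an automorphism, and
   such automorphisms move a homogeneous pointing to any pointing with the same
   value at a.  With the translations above they act transitively on S_w. *)

Set Implicit Arguments.
Unset Strict Implicit.
Unset Printing Implicit Defensive.

Import GRing.Theory passmx.
Local Open Scope ring_scope.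

(** * Elementary rules for the product *)

Section Products.
Variables (F : fieldType) (N : assocAlgebra F).
Implicit Types x y z : N.

Lemma amulDl x y z : amul (x + y) z = amul x z + amul y z.
Proof. by rewrite /amul linearD lfunE. Qed.

Lemma amulDr x y z : amul x (y + z) = amul x y + amul x z.
Proof. by rewrite /amul linearD. Qed.

Lemma amulZl c x y : amul (c *: x) y = c *: amul x y.
Proof. by rewrite /amul linearZ /= lfunE. Qed.

Lemma amulZr c x y : amul x (c *: y) = c *: amul x y.
Proof. by rewrite /amul linearZ. Qed.

Lemma amulNl x y : amul (- x) y = - amul x y.
Proof. by rewrite -scaleN1r amulZl scaleN1r. Qed.

Lemma amulNr x y : amul x (- y) = - amul x y.
Proof. by rewrite -scaleN1r amulZr scaleN1r. Qed.

Lemma amulBl x y z : amul (x - y) z = amul x z - amul y z.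
Proof. by rewrite amulDl amulNl. Qed.

Lemma amul0l x : amul 0 x = 0.
Proof. by rewrite -[X in amul X _](scale0r 0) amulZl scale0r. Qed.

Lemma amul0r x : amul x 0 = 0.
Proof. by rewrite -[X in amul _ X](scale0r 0) amulZr scale0r. Qed.

Lemma amulA : associative (@amul F N).
Proof. exact: alg_mulA. Qed.

Lemma amul_suml (I : Type) (r : seq I) (P : pred I) (u : I -> N) x :
  amul (\sum_(i <- r | P i) u i) x = \sum_(i <- r | P i) amul (u i) x.
Proof. by elim/big_rec2: _ => [|i ? ? _ <-]; rewrite ?amul0l ?amulDl. Qed.

Lemma amul_sumr (I : Type) (r : seq I) (P : pred I) (u : I -> N) x :
  amul x (\sum_(i <- r | P i) u i) = \sum_(i <- r | P i) amul x (u i).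
Proof. by elim/big_rec2: _ => [|i ? ? _ <-]; rewrite ?amul0r ?amulDr. Qed.

Lemma mem_annihilator_amul x y : x \in annihilator N -> amul x y = 0.
Proof. by move/annihilatorP; apply. Qed.

(** Every term of the series has degree at least 2, so one factor [x] splits off. *)
Lemma exp2_factor x : exists w, exp2 x = amul x w.
Proof.
exists (\sum_(2 <= k < (\dim {:N}).+1) (k`!%:R : F)^-1 *: apow x k.-1).
rewrite amul_sumr; apply: eq_big_nat => -[|[|k]] //= _.
by rewrite amulZr.
Qed.

Lemma exp2_annihilator x : x \in annihilator N -> exp2 x = 0.
Proof. by case: (exp2_factor x) => w ->; apply: mem_annihilator_amul. Qed.

Lemma exp2_0 : exp2 (0 : N) = 0.
Proof. by rewrite exp2_annihilator ?mem0v. Qed.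

End Products.

(* [exp x - 1], which makes sense in [N] although [exp x] does not. *)
HB.lock Definition expm1 (F : fieldType) (N : assocAlgebra F) (x : N) : N :=
  x + exp2 x.

Lemma expm1E (F : fieldType) (N : assocAlgebra F) (x : N) :
  expm1 x = x + exp2 x.
Proof. by rewrite unlock. Qed.

(** * Adjoining a unit to a commutative algebra *)

Section Unitization.
Variables (F : fieldType) (N : assocAlgebra F) (cN : commutative_alg N).

(** The proof [cN] is a parameter of the type, so that the commutative ring structure can be
    attached to it as an instance. *)
Definition unitization : Type := let _ := cN in (F^o * N)%type.

HB.instance Definition _ := GRing.Lmodule.copy unitization (F^o * N)%type.

Definition unitization_one : unitization := (1, 0).
Definition unitization_mul (x y : unitization) : unitization :=
  (x.1 * y.1, (x.1 : F) *: y.2 + (y.1 : F) *: x.2 + amul x.2 y.2).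

Fact unitization_mulC : commutative unitization_mul.
Proof.
by move=> [a x] [b y]; congr pair; rewrite /= ?[_ *: y + _]addrC 1?cN 1?mulrC.
Qed.

Fact unitization_mulA : associative unitization_mul.
Proof.
move=> [a x] [b y] [c z]; congr pair; rewrite /= ?mulrA //.
rewrite !scalerDr !amulDl !amulDr !amulZl !amulZr amulA !scalerA.
by rewrite ![c * _]mulrC !addrA [LHS](ACl (1*2*4*6*3*5*7)).
Qed.

Fact unitization_mul1 : left_id unitization_one unitization_mul.
Proof.
move=> [a x]; rewrite /unitization_mul /= mul1r scale1r scaler0 addr0 amul0l.
by rewrite addr0.
Qed.

Fact unitization_mulDl : left_distributive unitization_mul +%R.
Proof.
move=> [a x] [b y] [c z]; congr pair; rewrite /= ?mulrDl //.
by rewrite scalerDl scalerDr amulDl !addrA [LHS](ACl (1*3*5*2*4*6)).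
Qed.

Fact unitization_1neq0 : unitization_one != 0.
Proof. by apply/eqP => -[/eqP]; rewrite oner_eq0. Qed.

HB.instance Definition _ := GRing.Zmodule_isComNzRing.Build unitization
  unitization_mulA unitization_mulC unitization_mul1 unitization_mulDl
  unitization_1neq0.

Fact unitization_scaleAl (k : F) (x y : unitization) :
  k *: (x * y) = k *: x * y.
Proof.
case: x y => [a x] [b y]; congr pair; first by rewrite /= scalerAl.
by rewrite /= !scalerDr !scalerA amulZl -[k *: a]/(k * a) [b * k]mulrC.
Qed.

HB.instance Definition _ :=
  GRing.Lmodule_isLalgebra.Build F unitization unitization_scaleAl.
HB.instance Definition _ := GRing.Lalgebra_isComAlgebra.Build F unitization.

Definition in_unitization (x : N) : unitization := (0, x).
Fact in_unitization_is_linear : linear in_unitization.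
Proof. by move=> k x y; congr pair; rewrite /= ?scaler0 ?addr0. Qed.
HB.instance Definition _ :=
  GRing.isLinear.Build F N unitization _ in_unitization
    in_unitization_is_linear.

Lemma in_unitizationM x y :
  in_unitization (amul x y) = in_unitization x * in_unitization y.
Proof. by congr pair; rewrite /= ?mulr0 // !scale0r !add0r. Qed.

Lemma in_unitizationX x k : (0 < k)%N ->
  in_unitization (apow x k) = in_unitization x ^+ k.
Proof.
case: k => // k _; elim: k => [|k IHk]; first by rewrite expr1.
by rewrite exprS -IHk -in_unitizationM.
Qed.

End Unitization.

(** * The exponential law and surjectivity of [expm1] *)

Section Exponential.
Variables (F : fieldType) (charF0 : [pchar F] =i pred0) (N : assocAlgebra F).
Hypotheses (cN : commutative_alg N) (nilN : nilpotent_alg N).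
Hypothesis dimN : (0 < \dim {:N})%N.
Implicit Types x y z : N.

Local Notation iota := (in_unitization cN).

Lemma natf_neq0_pchar0 k : (k.+1%:R : F) != 0.
Proof. by move/pcharf0P: charF0 => ->. Qed.

Lemma fact_neq0_pchar0 k : (k`!%:R : F) != 0.
Proof. by case: k`! (fact_gt0 k) => // j _; apply: natf_neq0_pchar0. Qed.

Lemma in_unitization_nil x k : (\dim {:N} < k)%N -> iota x ^+ k = 0.
Proof.
move=> ltNk; rewrite -in_unitizationX ?(leq_ltn_trans _ ltNk) //.
by rewrite apow_gt_dim ?linear0.
Qed.

(** The series [exp (x T)] in a formal variable [T]. The cut loses nothing by nilpotency, and the
    variable separates degrees, so that the exponential law can be checked on coefficients. *)
Definition exp_poly x : {poly unitization cN} :=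
  \poly_(k < (\dim {:N}).+1) ((k`!%:R : F)^-1 *: iota x ^+ k).

Lemma coef_exp_poly x k : (exp_poly x)`_k = (k`!%:R : F)^-1 *: iota x ^+ k.
Proof.
rewrite coef_poly; case: ltnP => // leNk.
by rewrite in_unitization_nil ?scaler0.
Qed.

Lemma horner_exp_poly x : (exp_poly x).[1] = 1 + iota (expm1 x).
Proof.
rewrite horner_poly -(big_mkord xpredT
  (fun k => (k`!%:R : F)^-1 *: iota x ^+ k * 1 ^+ k)).
rewrite big_ltn // big_ltn // !expr1n !mulr1 !fact0 invr1 !scale1r expr1 expr0.
rewrite expm1E linearD; congr (_ + (_ + _)).
rewrite /exp2 linear_sum; apply: eq_big_nat => k /andP[k2 _].
by rewrite expr1n mulr1 linearZ /= in_unitizationX // ltnW.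
Qed.

Lemma exp_polyD x y : exp_poly (x + y) = exp_poly x * exp_poly y.
Proof.
(* In degree [k] the identity is the binomial theorem divided by [k!]. *)
apply/polyP => k; rewrite coefM coef_exp_poly linearD addrC exprDn scaler_sumr.
apply: eq_bigr => i _; rewrite !coef_exp_poly -scalerAl -scalerAr scalerA.
rewrite mulrC -scaler_nat scalerA; congr (_ *: _).
have lik : (i <= k)%N by rewrite -ltnS.
rewrite -(bin_fact lik) !natrM !invfM.
have := fact_neq0_pchar0 k; rewrite -(bin_fact lik) natrM mulf_eq0 negb_or.
case/andP=> b0 _.
by rewrite mulrAC mulVf // mul1r.
Qed.

Lemma expm1D x y :
  expm1 (x + y) = expm1 x + expm1 y + amul (expm1 x) (expm1 y).
Proof.
have := congr1 (fun q => q.[1]) (exp_polyD x y).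
rewrite hornerM !horner_exp_poly mulrDl mul1r mulrDr mulr1 -in_unitizationM.
rewrite -addrA => /addrI; rewrite -!linearD => /(congr1 snd) /= ->.
by rewrite addrCA addrA.
Qed.

Lemma expm1D_annihilator x a :
  a \in annihilator N -> expm1 (x + a) = expm1 x + a.
Proof.
move=> aN; have ea : expm1 a = a by rewrite expm1E exp2_annihilator ?addr0.
by rewrite expm1D ea [amul _ a]cN mem_annihilator_amul ?addr0.
Qed.

(* Newton iteration: if [expm1 x] approximates [y] up to [r], then
   [expm1 (x + r)] approximates [y] up to a multiple of [r]. *)
Lemma expm1_surj y : exists x, expm1 x = y.
Proof.
have [n nil_n] := nilN.
(* The induction is on the number [n] of factors that kill the residual. *)
suff approx x :
      (forall s : n.-tuple N, foldl (@amul F N) (y - expm1 x) s = 0) ->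
    exists x', expm1 x' = y by apply: (approx 0) => s; apply: nil_n.
elim: n x {nil_n} => [x /(_ [tuple]) /= /eqP | n IHn x nil_r].
  by rewrite subr_eq0 => /eqP ->; exists x.
pose r := y - expm1 x; have [w rw] := exp2_factor r.
apply: (IHn (x + r)) => s.
suff ->: y - expm1 (x + r)
    = amul r (- w - expm1 x - amul (expm1 x) w).
  exact: (nil_r [tuple of _ :: s]).
have er : expm1 r = r + amul r w by rewrite expm1E rw.
rewrite expm1D er [amul _ (_ + _)]amulDr [amul _ r]cN [amul _ (amul r w)]amulA.
rewrite [amul _ r]cN -amulA -[y](subrK (expm1 x)) -/r.
move: (expm1 x) r {rw er} => e r'.
by rewrite !amulDr !amulNr !opprD !addrA addrK subrr sub0r.
Qed.

End Exponential.

(** * Linear bijections and linear forms *)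

Section LinearBijections.
Variable F : fieldType.
Implicit Types U V W : vectType F.

Lemma dim_eq_inj_bij U V (f : 'Hom(U, V)) :
  \dim {:U} = \dim {:V} -> injective f -> bijective f.
Proof.
move=> dimUV injf; have kf : lker f == 0%VS by apply/lker0P.
exists (f^-1)%VF; first exact: lker0_lfunK.
move=> v; apply: limg_lfunVK; suff ->: limg f = fullv by exact: memvf.
by apply/eqP; rewrite eqEdim subvf -dimUV limg_dim_eq ?leqnn // (eqP kf) capv0.
Qed.

Lemma bij_lfun_dim U V (f : 'Hom(U, V)) :
  bijective f -> \dim {:U} = \dim {:V}.
Proof.
case=> g fK gK; have kf : lker f == 0%VS by apply/lker0P; apply: can_inj fK.
rewrite -(@limg_dim_eq _ _ _ f) ?(eqP kf) ?capv0 //; congr (\dim _).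
apply/eqP; rewrite eqEsubv subvf; apply/subvP => v _.
by rewrite -[v]gK memv_img ?memvf.
Qed.

Lemma bij_lfunK U V (f : 'Hom(U, V)) : bijective f ->
  cancel f f^-1%VF /\ cancel f^-1%VF f.
Proof.
case=> g fK gK; have fVK : cancel f f^-1%VF.
  by apply: lker0_lfunK; apply/lker0P; apply: can_inj fK.
by split=> // v; rewrite -{1}[v]gK fVK gK.
Qed.

Lemma bij_lfun_inv U V (f : 'Hom(U, V)) : bijective f -> bijective f^-1%VF.
Proof. by case/bij_lfunK => fK Kf; exists f. Qed.

Lemma bij_lfun_comp U V W (f : 'Hom(V, W)) (g : 'Hom(U, V)) :
  bijective f -> bijective g -> bijective (f \o g)%VF.
Proof.
case=> f' fK Kf [g' gK Kg]; exists (g' \o f') => x; rewrite /= !lfunE /=.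
  by rewrite fK gK.
by rewrite Kg Kf.
Qed.

End LinearBijections.

Section LinearForms.
Variables (F : fieldType) (V : vectType F).

(* A linear form with values in the regular module [F^o], seen as a map to [F]
   itself, where the field operations are available. *)
Definition lform (l : 'Hom(V, F^o)) : V -> F := l.

Fact lform_is_scalar l : scalar (lform l).
Proof. by move=> c x y; rewrite /lform linearP. Qed.
HB.instance Definition _ l :=
  GRing.isLinear.Build F V F *%R (lform l) (lform_is_scalar l).

End LinearForms.

(** * Traces of nilpotent endomorphisms *)

Section Trace.
Variable F : fieldType.

Lemma iter_mulmxr_mulmx n r (C : 'M[F]_(n, r)) (R : 'M_(r, n)) k (v : 'rV_r) :
  iter k.+1 (mulmxr (R *m C)) v = iter k (mulmxr (C *m R)) (v *m R) *m C.
Proof.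
elim: k => [|k IHk]; first by rewrite /= mulmxA.
by rewrite iterS IHk /= !mulmxA.
Qed.

(** Induction on the size. If the rank is below [n], a rank factorization [M = C R] gives
    [tr (C R) = tr (R C)] with a smaller nilpotent [R C]; a nilpotent matrix of full rank has size
    0. *)
Lemma mxtrace_nilpotent n (M : 'M[F]_n) :
  (exists m, forall v : 'rV_n, iter m (mulmxr M) v = 0) -> \tr M = 0.
Proof.
elim/ltn_ind: n M => n IHn M [m nilM].
have [ltMn | leMn] := ltnP (\rank M) n.
  rewrite -(mulmx_base M) mxtrace_mulC; apply: IHn => //; exists m.+1 => v.
  by rewrite iter_mulmxr_mulmx mulmx_base nilM mul0mx.
have freeM : row_free M by rewrite /row_free eqn_leq leMn rank_leq_row.
suff M0 : M = 0 by rewrite M0 mxtrace0.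
have v0 (v : 'rV[F]_n) : v = 0.
  elim: m nilM => [nilM | k IHk nilM]; first exact: (nilM v).
  apply: IHk => w.
  by apply: (row_free_inj freeM); rewrite mul0mx -(nilM w).
by apply/row_matrixP => i; rewrite [LHS]v0 [RHS]v0.
Qed.

Variable V : vectType F.
Local Notation e := (vbasis {:V}).

(** Defined for arbitrary maps, so that pointwise sums can be split without linearity proofs. *)
Definition vtrace (g : V -> V) : F := \sum_i coord e i (g e`_i).

Lemma vtraceD g h : vtrace (fun v => g v + h v) = vtrace g + vtrace h.
Proof. by rewrite -big_split; apply: eq_bigr => i _; rewrite linearD. Qed.

Lemma vtraceZ c g : vtrace (fun v => c *: g v) = c * vtrace g.
Proof. by rewrite mulr_sumr; apply: eq_bigr => i _; rewrite linearZ. Qed.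

Lemma eq_vtrace g h : g =1 h -> vtrace g = vtrace h.
Proof. by move=> gh; apply: eq_bigr => i _; rewrite gh. Qed.

Lemma vtrace_id : vtrace id = (\dim {:V})%:R.
Proof.
rewrite /vtrace (eq_bigr (fun=> 1)) ?sumr_const ?card_ord // => i _.
by rewrite coord_free ?eqxx // (basis_free (vbasisP _)).
Qed.

Lemma vtrace_rank1 (l : {scalar V}) v : vtrace (fun x => l x *: v) = l v.
Proof.
rewrite [in RHS](coord_vbasis (memvf v)) linear_sum; apply: eq_bigr => i _.
by rewrite !linearZ /= mulrC.
Qed.

Lemma vtrace_nilpotent (g : 'End(V)) m :
  (forall v, iter m g v = 0) -> vtrace g = 0.
Proof.
move=> nilg; have <-: \tr (mxof e e g) = vtrace g.
  by apply: eq_bigr => i _; rewrite mxE /= mxE vecof_delta.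
apply: mxtrace_nilpotent; exists m => v.
suff ->: iter m (mulmxr (mxof e e g)) v = rVof e (iter m g (vecof e v)).
  by rewrite nilg linear0.
have be : basis_of fullv e := vbasisP _.
elim: m {nilg} => [|k IHk] /=; first by rewrite vecofK ?(basis_free be).
by rewrite IHk mul_mxof rVofK.
Qed.

End Trace.

(** * Pointings and the form [w (x y)] *)

Section Pointings.
Variables (F : fieldType) (N : assocAlgebra F) (admN : admissible N).
Implicit Types (x y z a : N) (w : {scalar N}).

(* [w] is a pointing, normalized on the generator [a] of the annihilator. *)
Definition pointed (w : N -> F) a : Prop :=
  [/\ a \in annihilator N, w a = 1
    & forall x, x \in annihilator N -> x = w x *: a].

Lemma annihilator_line a x : a \in annihilator N -> a != 0 ->
  x \in annihilator N -> exists c, x = c *: a.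
Proof.
have [_ _ dimA] := admN => aA a0 xA; apply/vlineP.
suff -> : <[a]>%VS = annihilator N by [].
by apply/eqP; rewrite eqEdim -memvE aA dim_vline a0 dimA.
Qed.

Lemma pointed_of_neq0 w a :
  a \in annihilator N -> w a = 1 -> pointed w a.
Proof.
move=> aA wa; split=> // x xA.
have a0 : a != 0.
  by apply/eqP => a0; move/eqP: wa; rewrite a0 linear0 eq_sym oner_eq0.
have [c ->] := annihilator_line aA a0 xA.
by rewrite linearZ /= wa mulr1.
Qed.

Lemma pointing_pointed (omega : 'Hom(N, F^o)) :
  pointing omega -> exists a, pointed (lform omega) a.
Proof.
move=> pt; have : (1 : F^o) \in (omega @: annihilator N)%VS.
  by rewrite pt memvf.
case/memv_imgP => a aA wa; exists a.
exact: (@pointed_of_neq0 (lform omega)).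
Qed.

Lemma pointed_pointing (omega : 'Hom(N, F^o)) a :
  pointed (lform omega) a -> pointing omega.
Proof.
case=> aA wa _; apply/eqP; rewrite eqEsubv subvf; apply/subvP => c _.
have ->: c = omega (c *: a).
  by rewrite linearZ /= -[omega a]/(lform omega a) wa; apply/esym/mulr1.
by rewrite memv_img ?memvZ.
Qed.

(** Keep multiplying [x] by elements with nonzero product; by nilpotency this must reach the
    annihilator. *)
Lemma amul_into_annihilator x : x \notin annihilator N ->
  exists z, amul x z \in annihilator N /\ amul x z != 0.
Proof.
have [_ [n niln] _] := admN.
have: forall s : n.-tuple N, foldl (@amul F N) x s = 0 by move=> s; apply: niln.
elim: n x {niln} => [|n IHn] x nilx xA.
  by have /= x0 := nilx [tuple]; rewrite x0 mem0v in xA.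
have [y xy0] : exists y, amul x y != 0.
  move: xA; rewrite memv_ker => /lfunPn[y]; rewrite lfunE => xy; by exists y.
have [xyA | xyA] := boolP (amul x y \in annihilator N); first by exists y.
have [s | z [zA z0]] := IHn (amul x y) _ xyA.
  exact: (nilx [tuple of y :: s]).
by exists (amul y z); rewrite amulA.
Qed.

Section Nondegeneracy.
Variables (w : {scalar N}) (a : N) (pw : pointed w a).

Lemma pointed_neq0 : a != 0.
Proof.
case: pw => _ wa _; apply/eqP => a0.
by move/eqP: wa; rewrite a0 linear0 eq_sym oner_eq0.
Qed.

Lemma dim_admissible_gt0 : (0 < \dim {:N})%N.
Proof. by have [_ _ <-] := admN; rewrite dimvS ?subvf. Qed.

(** [w] is injective on the annihilator, and any [x] outside it has a nonzero multiple in it. *)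
Lemma form_nondegenerate x :
  (forall z, w (amul x z) = 0) -> x \in annihilator N.
Proof.
move=> wx0; apply/negPn/negP => /amul_into_annihilator[z [zA]].
by case: pw => _ _ /(_ _ zA) ->; rewrite wx0 scale0r eqxx.
Qed.

Lemma form_nondegenerate0 x :
  (forall z, w (amul x z) = 0) -> w x = 0 -> x = 0.
Proof.
move=> /form_nondegenerate xA wx.
by case: pw => _ _ /(_ _ xA) ->; rewrite wx scale0r.
Qed.

Lemma form_riesz (l : {scalar N}) :
  l a = 0 -> exists y, forall x, l x = w (amul x y).
Proof.
have [cN _ _] := admN; have [aA wa _] := pw => la.
pose e := vbasis {:N}.
(* [w (x y)] alone degenerates along the annihilator; adding [w x * w y] makes it nondegenerate. At
   [x = a] the sum is [w y], so [l a = 0] will remove the extra term. *)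
pose Phi y : 'rV[F]_(\dim {:N}) := \row_i (w (amul e`_i y) + w e`_i * w y).
have linPhi : linear Phi.
  move=> c x y; apply/rowP => i; rewrite !mxE amulDr amulZr.
  rewrite !linearD !linearZ /=.
  ring.
pose phi := GRing.isLinear.Build _ _ _ _ Phi linPhi.
pose PhiL : {linear N -> 'rV[F]_(\dim {:N})} := HB.pack Phi phi.
have PhiE y (l' : {scalar N}) :
    (forall i : 'I_(\dim {:N}), l' e`_i = Phi y 0 i) ->
    forall x, l' x = w (amul x y) + w x * w y.
  move=> l'E x; rewrite (coord_vbasis (memvf x)) amul_suml !linear_sum /=.
  rewrite mulr_suml -big_split; apply: eq_bigr => i _.
  by rewrite amulZl !linearZ /= l'E mxE mulrDr mulrA.
have injPhi : injective (linfun PhiL).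
  apply/lker0P; rewrite -subv0; apply/subvP => y.
  rewrite memv_ker lfunE /= memv0 => /eqP y0.
  have y1 x : 0 = w (amul x y) + w x * w y.
    apply: (PhiE y (\0 : {scalar N})) => i; by rewrite y0 mxE.
  have wy : w y = 0.
    by have := y1 a; rewrite mem_annihilator_amul // linear0 add0r wa mul1r.
  apply/eqP/form_nondegenerate0 => // z.
  by have := y1 z; rewrite wy mulr0 addr0 cN.
have [||Psi _ PhiK] := @dim_eq_inj_bij _ _ _ (linfun PhiL).
  by rewrite [RHS]dimvf dim_matrix mul1r.
  by [].
pose y := Psi (\row_i l e`_i).
have lE x : l x = w (amul x y) + w x * w y.
  apply: PhiE => i; have := PhiK (\row_i l e`_i).
  by rewrite lfunE /= -/y => ->; rewrite mxE.
have wy : w y = 0.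
  have := lE a; rewrite la mem_annihilator_amul // linear0 add0r wa mul1r.
  by move=> <-.
by exists y => x; rewrite lE wy mulr0 addr0.
Qed.

End Nondegeneracy.
End Pointings.

(** * Homomorphisms, twisted pointings and translations *)

Section Isomorphisms.
Variables (F : fieldType) (N N' : assocAlgebra F).
Hypotheses (nilN : nilpotent_alg N) (nilN' : nilpotent_alg N').
Variables (f : 'Hom(N, N')).
Hypothesis fM : forall x y, f (amul x y) = amul (f x) (f y).

Lemma alg_hom_apow x k : f (apow x k) = apow (f x) k.
Proof. by rewrite /apow; elim: k.-1 => //= j <-; rewrite fM. Qed.

Lemma alg_hom_expm1 x : f (expm1 x) = expm1 (f x).
Proof.
rewrite !expm1E linearD; congr (_ + _).
pose m := (maxn (\dim {:N}) (\dim {:N'})).+1.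
rewrite -(@exp2_widen _ _ _ m) ?ltnS ?leq_maxl //.
rewrite -(@exp2_widen _ _ _ m) ?ltnS ?leq_maxr // linear_sum.
by apply: eq_bigr => k _; rewrite linearZ /= alg_hom_apow.
Qed.

End Isomorphisms.

Section Twist.
Variables (F : fieldType) (N : assocAlgebra F).
Implicit Types (w : {scalar N}) (x y z : N).

(** The form [w] composed with multiplication by [1 + y]; for [y = expm1 v] it is
    [x |-> w (exp v x)]. *)
Definition twist w y x : F := w (x + amul y x).

Fact twist_is_scalar w y : scalar (twist w y).
Proof.
move=> c x x'; rewrite /twist -linearP; congr (w _).
by rewrite amulDr amulZr scalerDr !addrA [LHS](ACl (1*3*2*4)).
Qed.
HB.instance Definition _ w y :=
  GRing.isLinear.Build F N F *%R (twist w y) (twist_is_scalar w y).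

Section Admissible.
Variables (charF0 : [pchar F] =i pred0) (admN : admissible N).

Lemma pointed_twist w a y : pointed w a -> pointed (twist w y) a.
Proof.
have [cN _ _] := admN.
case=> aA wa _; apply: pointed_of_neq0 => //.
by rewrite /= /twist cN mem_annihilator_amul // addr0.
Qed.

Lemma expm1_translate w v z : w (expm1 v) = 0 ->
  w (expm1 (z + v)) = twist w (expm1 v) (expm1 z).
Proof.
have [cN nilN _] := admN; have dimN := dim_admissible_gt0 admN.
move=> wv; rewrite expm1D // /twist !linearD wv addr0.
by rewrite [amul (expm1 z) _]cN.
Qed.

Lemma pointed_eq_twist w w' a : pointed w a -> w' a = 1 ->
  exists v, w (expm1 v) = 0 /\ forall x, w' x = twist w (expm1 v) x.
Proof.
have [cN nilN _] := admN; have dimN := dim_admissible_gt0 admN.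
move=> pw w'a; have [aA wa _] := pw.
pose l x := w' x - w x.
have l_scalar : scalar l.
  move=> c x y; rewrite /l !linearP /=; ring.
pose lF := GRing.isLinear.Build _ _ _ _ l l_scalar.
pose lS : {scalar N} := HB.pack l lF.
have [|y ly] := form_riesz admN pw (l := lS).
  by rewrite /= /l w'a wa subrr.
(* Subtracting [w y *: a] does not change products with [y] and makes the value of [w] zero. *)
have [v ev] := expm1_surj charF0 cN nilN dimN (y - w y *: a).
exists v; rewrite ev linearB linearZ /= wa mulr1 subrr; split=> // x.
rewrite /twist amulBl amulZl (mem_annihilator_amul _ aA) scaler0 subr0 linearD.
by rewrite cN -ly /= /l addrC subrK.
Qed.

End Admissible.
End Twist.

Section AffineChange.
Variables (F : fieldType) (charF0 : [pchar F] =i pred0) (N N' : assocAlgebra F).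
Variables (admN : admissible N) (admN' : admissible N').
Variables (w : {scalar N}) (a : N) (pw : pointed w a).
Variables (w' : {scalar N'}) (a' : N') (pw' : pointed w' a').

Lemma alg_iso_affine (f : 'Hom(N, N')) : bijective f ->
    (forall x y, f (amul x y) = amul (f x) (f y)) ->
  exists b, forall z, w (expm1 z) = 0 <-> w' (expm1 (f z + b)) = 0.
Proof.
have [_ nilN _] := admN; have [_ nilN' _] := admN'; have [aA wa _] := pw.
move=> fbij fM; have [fK Kf] := bij_lfunK fbij.
have faA : f a \in annihilator N'.
  apply/annihilatorP => y; rewrite -[y]Kf -fM.
  by rewrite mem_annihilator_amul ?linear0.
(* [f a] is a nonzero element of the annihilator, so [c] is nonzero, and dividing by it normalizes
   the pulled-back pointing at [a]. *)
pose c := w' (f a).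
have c0 : c != 0.
  apply/eqP => c0; have [_ _ /(_ _ faA)] := pw'.
  rewrite -/c c0 scale0r => /(congr1 f^-1%VF); rewrite fK linear0 => a0.
  by have := pointed_neq0 pw; rewrite a0 eqxx.
pose w1 x := c^-1 * w' (f x).
have w1_scalar : scalar w1 by move=> k x y; rewrite /w1 !linearP /=; ring.
pose w1F := GRing.isLinear.Build _ _ _ _ w1 w1_scalar.
pose w1S : {scalar N} := HB.pack w1 w1F.
have w1a : w1S a = 1 by rewrite /= /w1 mulVf.
have [v [w1v wE]] :=
  pointed_eq_twist charF0 admN (pointed_of_neq0 admN aA w1a) wa.
exists (f v) => z; rewrite wE -expm1_translate // /= /w1.
rewrite alg_hom_expm1 // linearD.
split=> [/eqP|->]; last by rewrite mulr0.
by rewrite mulf_eq0 invr_eq0 (negPf c0) => /eqP.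
Qed.

End AffineChange.

(** * Graphs of nil-polynomials as hypersurfaces *)

Section Charts.
Variables (F : fieldType) (charF0 : [pchar F] =i pred0) (N : assocAlgebra F).
Variable (admN : admissible N).

Lemma graph_chart (W : vectType F) (p : W -> F) (omega : 'Hom(N, F^o)) (a : N)
    (phi : 'Hom(W, subvs_of (lker omega))) :
  pointed (lform omega) a -> bijective phi ->
  (forall x, p x = omega (exp2 (vsval (phi x)))) ->
  exists chi : 'Hom((W * F^o)%type, N), bijective chi /\
    forall z, graph p z <-> lform omega (expm1 (chi z)) = 0.
Proof.
have [cN nilN _] := admN; have dimN := dim_admissible_gt0 admN.
move=> [aA wa _] phi_bij pE; pose w : {scalar N} := lform omega.
rewrite -[lform omega]/(w : N -> F) in wa *.
(* Adding an annihilator element translates [expm1], and [phi] lands in the kernel of [w], so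
   [w (expm1 (chi (x, t))) = p x - t]. *)
pose chi (z : (W * F^o)%type) : N := vsval (phi z.1) - (z.2 : F) *: a.
have wphi x : w (vsval (phi x)) = 0.
  by have := subvsP (phi x); rewrite memv_ker => /eqP.
have wchi z : w (chi z) = - z.2.
  by rewrite linearB linearZ /= wphi wa mulr1 sub0r.
have chi_linear : linear chi.
  move=> c [x s] [y t]; rewrite /chi /= linearP linearP scalerBr scalerDl.
  by rewrite scalerA opprD !addrA [LHS](ACl (1*3*2*4)).
pose chiF := GRing.isLinear.Build _ _ _ _ chi chi_linear.
pose chiL : {linear (W * F^o)%type -> N} := HB.pack chi chiF.
exists (linfun chiL); split.
  have [psi phiK psiK] := phi_bij.
  exists (fun z => (psi (vsproj _ (z + - w z *: a)), - w z)) => [[x t] | z].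
    rewrite lfunE /= wchi opprK; congr pair.
    by rewrite /chi /= subrK vsvalK phiK.
  rewrite lfunE /= /chi /= psiK vsprojK ?scaleNr ?opprK ?subrK //.
  rewrite memv_ker; apply/eqP.
  by rewrite [LHS](linearB w) linearZ /= wa mulr1 subrr.
case=> x t; rewrite lfunE /= /graph /= pE /chi /=.
rewrite -scaleNr expm1D_annihilator ?memvZ // linearD expm1E linearD /=.
rewrite wphi add0r.
rewrite linearZ /= wa mulr1; split=> [-> | /eqP].
  by rewrite subrr.
by rewrite subr_eq0 => /eqP.
Qed.

Lemma nil_polynomial_chart (W : vectType F) (p : W -> F) :
  nil_polynomial N p ->
  exists (w : {scalar N}) (a : N) (chi : 'Hom((W * F^o)%type, N)),
    [/\ pointed w a, bijective chi
      & forall z, graph p z <-> w (expm1 (chi z)) = 0].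
Proof.
case=> omega [pt [phi [phi_bij pE]]].
have [a pa] := pointing_pointed admN pt.
have [chi [chi_bij chiP]] := graph_chart pa phi_bij pE.
by exists (lform omega), a, chi.
Qed.

End Charts.

(** * Coefficient comparison and polarization *)

Section PolynomialIdentities.
Variables (F : fieldType) (charF0 : [pchar F] =i pred0).

Lemma natr_inj_pchar0 : injective (fun k => k%:R : F).
Proof.
suff lt_neq i j : (i < j)%N -> (i%:R : F) != j%:R.
  move=> i j ij; case: (ltngtP i j) => // /lt_neq.
    by rewrite ij eqxx.
  by rewrite ij eqxx.
move=> ltij; rewrite eq_sym -subr_eq0 -natrB ?(ltnW ltij) //.
move: ltij; rewrite -subn_gt0; case: (j - i)%N => // k _.
exact: natf_neq0_pchar0.
Qed.

Lemma horner_eq0_pchar0 (q : {poly F}) : (forall s, q.[s] = 0) -> q = 0.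
Proof.
move=> q0; apply/eqP; apply: contraT => nzq.
have /(max_poly_roots nzq) : all (root q) [seq k%:R : F | k <- iota 0 (size q)].
  by apply/allP => s _; apply/rootP.
rewrite size_map size_iota ltnn map_inj_uniq ?iota_uniq; first by move/(_ isT).
exact: natr_inj_pchar0.
Qed.

(** Applying [l] to the coefficients gives a polynomial over [F] that vanishes everywhere. *)
Lemma scalar_horner_eq0 (A : algType F) (l : {scalar A}) (q : {poly A}) :
  (forall s : F, l q.[s%:A] = 0) -> forall i, l q`_i = 0.
Proof.
move=> lq0; pose P := \poly_(i < size q) l q`_i.
have P0 : P = 0.
  apply: horner_eq0_pchar0 => s; apply: etrans (lq0 s).
  rewrite horner_poly [in RHS]horner_coef linear_sum; apply: eq_bigr => i _.
  by rewrite exprZn expr1n -scalerAr mulr1 linearZ mulrC.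
move=> i; have := congr1 (fun q : {poly F} => q`_i) P0.
rewrite coef0 coef_poly; case: ltnP => // le_q _.
by rewrite nth_default ?linear0.
Qed.

End PolynomialIdentities.

Section Polarization.
Variables (F : fieldType) (charF0 : [pchar F] =i pred0) (V : zmodType).

Lemma polarize2 (B : V -> V -> F) :
  (forall x y z, B (x + y) z = B x z + B y z) -> (forall x y, B x y = B y x) ->
  (forall x, B x x = 0) -> forall x y, B x y = 0.
Proof.
move=> addB symB B0 x y.
have two0 : (2%:R : F) != 0 := natf_neq0_pchar0 charF0 1.
have addBr u v z : B u (v + z) = B u v + B u z.
  by rewrite symB addB ![B _ u]symB.
have := B0 (x + y); rewrite addB !addBr !B0 [B y x]symB add0r addr0 => B2.
by apply: (mulfI two0); rewrite mulr0 -B2; ring.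
Qed.

Lemma polarize3 (T : V -> V -> V -> F) :
  (forall x y z t, T (x + y) z t = T x z t + T y z t) ->
  (forall x y z, T x y z = T y x z) -> (forall x y z, T x y z = T x z y) ->
  (forall x, T x x x = 0) -> forall x y z, T x y z = 0.
Proof.
move=> addT sym12 sym23 T0 x y z.
have two0 : (2%:R : F) != 0 := natf_neq0_pchar0 charF0 1.
have three0 : (3%:R : F) != 0 := natf_neq0_pchar0 charF0 2.
have addT2 u v s t : T u (v + s) t = T u v t + T u s t.
  by rewrite sym12 addT ![T _ u t]sym12.
have addT3 u v s t : T u v (s + t) = T u v s + T u v t.
  by rewrite sym23 addT2 ![T u _ v]sym23.
have E u v : T u u v + T u v v = 0.
  have := T0 (u + v); rewrite addT !addT2 !addT3 !T0.
  rewrite [T u v u]sym23 [T v u u]sym12 [T u v u]sym23.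
  rewrite [T v v u]sym23 [T v u v]sym12 => E.
  by apply: (mulfI three0); rewrite mulr0 -E; ring.
(* Doubling [v] multiplies the two terms of [E u v] by 2 and 4, so each vanishes. *)
have Tuuv u v : T u u v = 0.
  have Tuvv s : T u s s = - T u u s by rewrite (addr0_eq (E u s)).
  have := E u (v + v); rewrite addT2 !addT3 Tuvv => E2.
  by apply: (mulfI two0); rewrite mulr0 -oppr0 -E2; ring.
apply: (polarize2 (B := T x)) => [u v t | u v | u].
- by rewrite addT2.
- by rewrite sym23.
by rewrite sym12 sym23 Tuuv.
Qed.
End Polarization.

(** * Powers of scaled elements *)

Section PowerSums.
Variables (F : fieldType) (N : assocAlgebra F).

Lemma apowZ s (x : N) k : apow (s *: x) k.+1 = s ^+ k.+1 *: apow x k.+1.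
Proof.
elim: k => [|k IHk]; first by rewrite expr1.
have -> : apow (s *: x) k.+2 = amul (s *: x) (apow (s *: x) k.+1) by [].
by rewrite IHk amulZl amulZr scalerA -exprS.
Qed.

(** The bound [m] is left free so that the first three terms can be split off in any dimension. *)
Lemma expm1_sum (nilN : nilpotent_alg N) (x : N) m :
  (\dim {:N} <= m)%N -> (0 < m)%N ->
  expm1 x = \sum_(k < m) (k.+1`!%:R : F)^-1 *: apow x k.+1.
Proof.
move=> leNm m0; rewrite expm1E -(@exp2_widen _ _ x m.+1) ?ltnS //.
rewrite -(big_mkord xpredT (fun k => (k.+1`!%:R : F)^-1 *: apow x k.+1)).
by rewrite big_ltn // invr1 scale1r [in LHS]big_add1.
Qed.

End PowerSums.

Lemma iter_amul_nil (F : fieldType) (N : assocAlgebra F) :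
  commutative_alg N -> nilpotent_alg N ->
  exists m, forall x y : N, iter m (amul x) y = 0.
Proof.
move=> cN [m nilN]; exists m => x y.
suff -> : iter m (amul x) y = foldl (@amul F N) y (nseq m x).
  exact: (nilN y [tuple of nseq m x]).
by elim: m y {nilN} => // m IHm y; rewrite iterSr IHm /= cN.
Qed.

(** * From a linear map of hypersurfaces to an algebra isomorphism *)

Section LinearMaps.
Variables (F : fieldType) (charF0 : [pchar F] =i pred0) (N N' : assocAlgebra F).
Variables (admN : admissible N) (admN' : admissible N').
Variables (w : {scalar N}) (a : N) (pw : pointed w a).
Variables (w' : {scalar N'}) (a' : N') (pw' : pointed w' a').
Variables (f : 'Hom(N, N')) (f_bij : bijective f).
Hypothesis f_graph : forall z, w (expm1 z) = 0 -> w' (expm1 (f z)) = 0.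

Let cN : commutative_alg N. Proof. by case: admN. Qed.
Let cN' : commutative_alg N'. Proof. by case: admN'. Qed.
Let nilN : nilpotent_alg N. Proof. by case: admN. Qed.
Let nilN' : nilpotent_alg N'. Proof. by case: admN'. Qed.
Let aA : a \in annihilator N. Proof. by case: pw. Qed.
Let aA' : a' \in annihilator N'. Proof. by case: pw'. Qed.
Let wa : w a = 1. Proof. by case: pw. Qed.
Let wa' : w' a' = 1. Proof. by case: pw'. Qed.
Let dimN : (0 < \dim {:N})%N := dim_admissible_gt0 admN.

(** The extension of [w'] by 0 on scalars; it allows polynomials over a unital ring. *)
Definition snd_form (y : unitization cN') : F := w' y.2.
Fact snd_form_is_scalar : scalar snd_form.
Proof. by move=> c x y; rewrite /snd_form linearP. Qed.
HB.instance Definition _ :=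
  GRing.isLinear.Build F (unitization cN') F *%R snd_form snd_form_is_scalar.

(* The tangential part of [f] along the points [s x - w (expm1 (s x)) a] of the
   hypersurface. *)
Definition tangent x : N' := f x - w x *: f a.

Local Notation iota := (in_unitization cN').

(* The coefficients of [s], [s ^ 2] and [s ^ 3] in [w' (expm1 (f z))], where [z]
   is the point of the hypersurface over [s x]. *)
Lemma graph_map_jet x (g := tangent x) :
  [/\ w' g = 0, w' (amul g g) = w' (f a) * w (amul x x)
    & w' (amul g (amul g g)) = w' (f a) * w (amul x (amul x x))
                               + 3%:R * w (amul x x) * w' (amul g (f a))].
Proof.
pose A := unitization cN'.
(* [w (expm1 (s x))] divided by [s], as a polynomial in [s]; the bound makes its coefficients in
   degrees 0, 1, 2 explicit. *)
pose r := \poly_(k < (\dim {:N}) + 3) ((k.+1`!%:R : F)^-1 * w (apow x k.+1)).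
have rE s : s * r.[s] = w (expm1 (s *: x)).
  rewrite (@expm1_sum _ _ nilN _ (\dim {:N} + 3)) ?leq_addr ?addn3 //.
  rewrite -addn3 horner_poly linear_sum mulr_sumr; apply: eq_bigr => k _.
  by rewrite apowZ !linearZ /= exprS; ring.
(* ['X * Z] is the image of the curve under [f], and [Q] is [expm1] of it. *)
pose Z : {poly A} := (iota (f x))%:P - map_poly (in_alg A) r * (iota (f a))%:P.
pose Q : {poly A} := \sum_(k < 3 + \dim {:N'})
  ((k.+1`!%:R : F)^-1%:A)%:P * ('X * Z) ^+ k.+1.
have Q0 s : snd_form Q.[s%:A] = 0.
  have ZE : ('X * Z).[s%:A] = iota (f (s *: x - w (expm1 (s *: x)) *: a)).
    rewrite hornerM hornerX hornerD hornerN hornerM !hornerC.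
    have -> : f (s *: x - w (expm1 (s *: x)) *: a) = s *: (f x - r.[s] *: f a).
      by rewrite scalerBr scalerA rE linearB !linearZ /= ?scalerN.
    rewrite (horner_map (in_alg A)) /= linearZ linearB linearZ /= ?scalerN.
    by rewrite -!scalerAl !mul1r.
  have -> : Q.[s%:A] = iota (expm1 (f (s *: x - w (expm1 (s *: x)) *: a))).
    rewrite horner_sum (@expm1_sum _ _ nilN' _ (3 + \dim {:N'})) ?leq_addl //.
    rewrite linear_sum; apply: eq_bigr => k _.
    rewrite [RHS]linearZ /= hornerM hornerC horner_exp ZE in_unitizationX //.
    by rewrite -scalerAl mul1r.
  apply: f_graph; rewrite expm1D_annihilator //.
    by rewrite linearB linearZ /= wa mulr1 subrr.
  by rewrite memvN memvZ.
have Qn n : snd_form Q`_n = 0.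
  exact: (@scalar_horner_eq0 _ charF0 _ snd_form).
have Z_coef n :
    Z`_n = (if n == 0%N then iota (f x) else 0) - r`_n *: iota (f a).
  by rewrite coefB coefMC coef_map coefC /= -scalerAl mul1r.
have Q_coef n : Q`_n = \sum_(k < 3 + \dim {:N'})
    if (n < k.+1)%N then 0 else (k.+1`!%:R : F)^-1 *: (Z ^+ k.+1)`_(n - k.+1).
  rewrite coef_sum; apply: eq_bigr => k _.
  rewrite coefCM exprMn coefXnM -scalerAl mul1r.
  by case: ifP; rewrite ?scaler0.
(* The power [k.+1] of ['X * Z] is divisible by that of ['X], so three summands suffice. *)
have Q_low n : (n <= 3)%N -> Q`_n = \sum_(k < 3)
    if (n < k.+1)%N then 0 else (k.+1`!%:R : F)^-1 *: (Z ^+ k.+1)`_(n - k.+1).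
  move=> len3; rewrite Q_coef big_split_ord /= [X in _ + X]big1 ?addr0 //.
  move=> k _ /=.
  by rewrite /= ltnS (leq_trans len3) // leq_addr.
have [r0 r1 r2] : [/\ r`_0 = w x, r`_1 = 2%:R^-1 * w (amul x x)
    & r`_2 = 6%:R^-1 * w (amul x (amul x x))].
  by split; rewrite coef_poly addn3 //= invr1 mul1r.
have Z0 : Z`_0 = iota g by rewrite Z_coef r0 -linearZ -linearB.
have Z1 : Z`_1 = - (2%:R^-1 * w (amul x x)) *: iota (f a).
  by rewrite Z_coef r1 add0r scaleNr.
have Z2 : Z`_2 = - (6%:R^-1 * w (amul x (amul x x))) *: iota (f a).
  by rewrite Z_coef r2 add0r scaleNr.
have sndE y : snd_form (iota y) = w' y by [].
have two0 : (2%:R : F) != 0 := natf_neq0_pchar0 charF0 1.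
have three0 : (3%:R : F) != 0 := natf_neq0_pchar0 charF0 2.
have six0 : (6%:R : F) != 0 := natf_neq0_pchar0 charF0 5.
have g0 : w' g = 0.
  have := Qn 1; rewrite Q_low // !big_ord_recl big_ord0 /= !addr0.
  by rewrite expr1 invr1 scale1r Z0 sndE.
have jet_eq (u t k : F) : k * t = u -> t = 0 -> u = 0.
  by move=> <- ->; rewrite mulr0.
split=> //; apply/eqP; rewrite -subr_eq0; apply/eqP.
  have := Qn 2; rewrite Q_low // !big_ord_recl big_ord0 /= !addr0.
  rewrite expr1 invr1 scale1r expr2 coef0M Z0 Z1 -in_unitizationM.
  rewrite linearD !linearZ /= !sndE -[(bump 0 0).+1`!%:R]/(2%:R).
  by apply: (@jet_eq _ _ 2%:R); field.
have := Qn 3; rewrite Q_low // !big_ord_recl big_ord0 /= !addr0.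
rewrite expr1 invr1 scale1r expr2 coefM !big_ord_recl big_ord0 /= addr0.
rewrite 2!exprS expr1 !coef0M Z0 Z1 Z2 -!in_unitizationM.
rewrite -!scalerAl -!scalerAr -!in_unitizationM.
rewrite !linearD !linearZ /= !sndE.
rewrite -[(bump 0 0).+1`!%:R]/(2%:R) -[_.+1`!%:R]/(6%:R) [amul (f a) g]cN'.
apply: (@jet_eq _ _ 6%:R); field.
by rewrite two0 six0.
Qed.

(** Otherwise the tangent part of the preimage of [a'] would have value [w' a' = 1], but [w']
    vanishes on tangent parts. *)
Lemma form_image_neq0 : w' (f a) != 0.
Proof.
have [_ Kf] := bij_lfunK f_bij.
apply/eqP => c0; have [g0 _ _] := graph_map_jet (f^-1%VF a').
move: g0; rewrite /tangent Kf linearB linearZ /= c0 mulr0 subr0 wa'.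
by move/eqP; rewrite oner_eq0.
Qed.

(** [tangent] kills [a] and lands in the kernel of [w']; the added term sends [a] to a nonzero
    multiple of [a'], which restores injectivity. Products do not see it. *)
Definition iso_candidate x : N' := tangent x + (w' (f a) * w x) *: a'.

Fact iso_candidate_is_linear : linear iso_candidate.
Proof.
move=> k x y; rewrite /iso_candidate /tangent !linearP /= !mulrDr !scalerDl.
rewrite !opprD !scalerDr scalerN !scalerA mulrCA.
by rewrite !addrA [LHS](ACl (1*3*5*2*4*6)).
Qed.
HB.instance Definition _ :=
  GRing.isLinear.Build F N N' _ iso_candidate iso_candidate_is_linear.

Local Notation psi := iso_candidate.
Local Notation c := (w' (f a)).

Lemma form_iso_candidate x : w' (psi x) = c * w x.
Proof.
have [g0 _ _] := graph_map_jet x.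
by rewrite linearD linearZ /= g0 wa' mulr1 add0r.
Qed.

Lemma iso_candidate_mulr x z : amul z (psi x) = amul z (tangent x).
Proof.
rewrite amulDr amulZr [amul z a']cN' (mem_annihilator_amul _ aA').
by rewrite scaler0 addr0.
Qed.

Lemma iso_candidate_mull x z : amul (psi x) z = amul (tangent x) z.
Proof. by rewrite cN' iso_candidate_mulr cN'. Qed.

Lemma iso_candidate_inj : injective psi.
Proof.
apply: raddf_inj => x psi0.
have wx : w x = 0.
  apply: (mulfI form_image_neq0); rewrite -form_iso_candidate psi0.
  by rewrite linear0 mulr0.
move: psi0; rewrite /= /iso_candidate /tangent wx mulr0 !scale0r subr0 addr0.
by move=> fx0; apply: (bij_inj f_bij); rewrite fx0 linear0.
Qed.

Lemma iso_candidate_form2 x y : w' (amul (psi x) (psi y)) = c * w (amul x y).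
Proof.
apply/eqP; rewrite -subr_eq0; apply/eqP.
pose B x y := w' (amul (psi x) (psi y)) - c * w (amul x y).
apply: (@polarize2 _ charF0 _ B) => [u v z | u v | u].
- by rewrite /B linearD !amulDl !linearD /=; ring.
- by rewrite /B cN' [amul u v]cN.
have [_ g2 _] := graph_map_jet u.
by rewrite /B iso_candidate_mulr iso_candidate_mull g2 subrr.
Qed.

(** Polarization of the cubic jet identity; its factor 3 becomes a symmetric sum of three terms. *)
Lemma iso_candidate_form3 x y z :
  w' (amul (psi x) (amul (psi y) (psi z))) = c * w (amul x (amul y z))
  + (w (amul x y) * w' (amul (psi z) (f a))
     + w (amul y z) * w' (amul (psi x) (f a))
     + w (amul x z) * w' (amul (psi y) (f a))).
Proof.
apply/eqP; rewrite -subr_eq0; apply/eqP.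
pose T x y z := w' (amul (psi x) (amul (psi y) (psi z))) -
  (c * w (amul x (amul y z))
  + (w (amul x y) * w' (amul (psi z) (f a))
     + w (amul y z) * w' (amul (psi x) (f a))
     + w (amul x z) * w' (amul (psi y) (f a)))).
apply: (@polarize3 _ charF0 _ T) => [u v s t | u v s | u v s | u].
- by rewrite /T linearD !amulDl !linearD /=; ring.
- rewrite /T amulA [amul (psi u) (psi v)]cN' -amulA.
  rewrite [amul u (amul v s)]amulA [amul u v]cN -amulA; ring.
- rewrite /T [amul (psi s) (psi v)]cN' [amul s v]cN; ring.
have [_ _ g3] := graph_map_jet u.
rewrite /T !iso_candidate_mulr !iso_candidate_mull g3; ring.
Qed.

Lemma iso_candidate_bij : bijective (linfun psi).
Proof.
apply: dim_eq_inj_bij; first exact: bij_lfun_dim f_bij.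
by move=> x y; rewrite !lfunE => /iso_candidate_inj.
Qed.

Local Notation psiV := (linfun psi)^-1%VF.

Let psiVK y : psi (psiV y) = y.
Proof.
by have [_ Kf] := bij_lfunK iso_candidate_bij; rewrite -[RHS]Kf lfunE.
Qed.

Let psiK x : psiV (psi x) = x.
Proof.
by have [fK _] := bij_lfunK iso_candidate_bij; rewrite -[RHS]fK lfunE.
Qed.

(* The product of [N'] transported to [N] differs from that of [N] by terms
   whose trace is [(dim N + 1) w (x b)], where [b] is the preimage of [f a]; but
   multiplication operators of nilpotent algebras have trace 0. *)
Lemma iso_candidate_trace x : w (amul x (psiV (f a))) = 0.
Proof.
set b := psiV (f a); have fa : f a = psi b by rewrite psiVK.
pose th y := psiV (amul (psi x) (psi y)).
(* The subtracted terms are those of the cubic identity, so [w (D y z) = 0] for all [z] and [D y] is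
   a multiple of [a]. *)
pose D y := th y - amul x y - w (amul x y) *: b - w (amul x b) *: y
  - w (amul b y) *: x.
have DE y : D y = w (D y) *: a.
  have [_ _] := pw; apply; apply: (form_nondegenerate admN pw) => z.
  have thz : c * w (amul (th y) z) = w' (amul (psi x) (amul (psi y) (psi z))).
    by rewrite -iso_candidate_form2 psiVK -amulA.
  apply: (mulfI form_image_neq0); rewrite mulr0 /D !amulBl !linearB /= !mulrBr.
  rewrite thz iso_candidate_form3 fa !iso_candidate_form2 !amulZl !linearZ /=.
  rewrite -amulA [amul z b]cN [amul y b]cN -?fa; ring.
have thE y : th y = amul x y + (w (amul x y) *: b + (w (amul x b) *: y
    + (w (amul b y) *: x + w (D y) *: a))).
  rewrite -DE /D [w (amul b y) *: x + _]addrC subrK [_ *: y + _]addrC subrK.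
  by rewrite [_ *: b + _]addrC subrK addrC subrK.
have psia : psi a = c *: a'.
  by rewrite /iso_candidate /tangent wa scale1r subrr add0r mulr1.
have wDa : w (D a) = - w (amul x b).
  have tha : th a = 0.
    rewrite /th psia amulZr [amul _ a']cN' mem_annihilator_amul //.
    by rewrite scaler0 linear0.
  rewrite /D tha [amul x a]cN [amul b a]cN !(mem_annihilator_amul _ aA).
  rewrite !linear0.
  by rewrite !scale0r !subr0 addr0 sub0r linearN linearZ /= wa mulr1.
pose thL : 'End(N) := (psiV \o (alg_mul N' (psi x) \o linfun psi))%VF.
have thLE : thL =1 th by move=> y; rewrite !lfunE /= !lfunE /= !lfunE.
have trth : vtrace th = 0.
  rewrite -(eq_vtrace thLE).
  have [m nilx] := iter_amul_nil cN' nilN'.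
  apply: (@vtrace_nilpotent _ _ _ m) => y.
  rewrite (eq_iter thLE).
  suff -> : iter m th y = psiV (iter m (amul (psi x)) (psi y)).
    by rewrite nilx linear0.
  elim: m {nilx} => [|m IHm]; first by rewrite /= psiK.
  by rewrite iterS IHm /th psiVK.
have trmul : vtrace (amul x) = 0.
  have [m nilx] := iter_amul_nil cN nilN.
  by apply: (@vtrace_nilpotent _ _ (alg_mul N x) m) => y; apply: nilx.
(* The terms along [b] and [x] give [w (x b)] each, the identity map gives [dim N] times it, and [D]
   gives [w (D a) = - w (x b)]. *)
have := trth; rewrite (eq_vtrace thE) !vtraceD trmul vtraceZ vtrace_id.
have D_scalar : scalar (fun y => w (D y)).
  move=> k u v; rewrite /D -!thLE linearP !amulDr !amulZr !linearB !linearD /=.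
  by rewrite !linearZ /=; ring.
pose DF := GRing.isLinear.Build _ _ _ _ _ D_scalar.
pose DS : {scalar N} := HB.pack (fun y => w (D y)) DF.
rewrite (vtrace_rank1 (w \o alg_mul N x)) (vtrace_rank1 (w \o alg_mul N b)).
rewrite (vtrace_rank1 DS) /= wDa -!/(amul _ _) [amul b x]cN => tr0.
apply: (mulfI (natf_neq0_pchar0 charF0 (\dim {:N}))).
by rewrite mulr0 -tr0 -natr1; ring.
Qed.

(** Once the extra cubic terms vanish, [psi (x y) - psi x psi y] is orthogonal to every [psi z] and
    killed by [w'], hence zero. *)
Lemma linear_graph_map_iso : isomorphic_alg N N'.
Proof.
exists (linfun psi); split=> [|x y]; first exact: iso_candidate_bij.
have w_fa z : w' (amul (psi z) (f a)) = 0.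
  rewrite -[f a]psiVK iso_candidate_form2 iso_candidate_trace.
  by rewrite mulr0.
rewrite !lfunE /=; apply/eqP; rewrite -subr_eq0; apply/eqP.
apply: (form_nondegenerate0 admN' pw') => [z |]; last first.
  by rewrite linearB form_iso_candidate iso_candidate_form2 subrr.
rewrite -[z]psiVK amulBl linearB -amulA iso_candidate_form3 !w_fa.
by rewrite iso_candidate_form2 -amulA !mulr0 !addr0 subrr.
Qed.

End LinearMaps.

(** * Automorphisms of graded algebras *)

Section UnitMultiplication.
Variables (F : fieldType) (N : assocAlgebra F) (cN : commutative_alg N).
Implicit Types x y z : N.

(* Multiplication by [(1 - y) ^ k]. *)
Fixpoint unit_mul y k : 'End(N) :=
  if k is k'.+1 then ((\1 - alg_mul N y) \o unit_mul y k')%VF else \1%VF.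

Lemma unit_mul0 y x : unit_mul y 0 x = x.
Proof. by rewrite lfunE. Qed.

Lemma unit_mulS y k x :
  unit_mul y k.+1 x = unit_mul y k x - amul y (unit_mul y k x).
Proof. by rewrite /= comp_lfunE add_lfunE opp_lfunE lfunE. Qed.

Lemma unit_mulAl y k x z : amul (unit_mul y k x) z = unit_mul y k (amul x z).
Proof.
elim: k => [|k IHk]; first by rewrite !unit_mul0.
by rewrite !unit_mulS amulBl -amulA IHk.
Qed.

Lemma unit_mulD y j k x : unit_mul y (j + k) x = unit_mul y j (unit_mul y k x).
Proof.
elim: j => [|j IHj]; first by rewrite unit_mul0.
by rewrite addSn !unit_mulS IHj.
Qed.

Lemma unit_mulM y j k x z :
  amul (unit_mul y j x) (unit_mul y k z) = unit_mul y (j + k) (amul x z).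
Proof. by rewrite unit_mulAl cN unit_mulAl cN unit_mulD. Qed.

Lemma unit_mul_nil2 y k x : amul y (amul y x) = 0 ->
  unit_mul y k x = x - k%:R *: amul y x.
Proof.
move=> yyx; elim: k => [|k IHk]; first by rewrite unit_mul0 scale0r subr0.
rewrite unit_mulS IHk amulDr amulNr amulZr yyx scaler0 oppr0 addr0.
by rewrite -addrA -opprD -natr1 scalerDl scale1r.
Qed.

End UnitMultiplication.

Section Gradings.
Variables (F : fieldType) (charF0 : [pchar F] =i pred0) (N : assocAlgebra F).
Variable admN : admissible N.
Implicit Types x y z : N.

Lemma grading_projections G : is_grading G ->
  exists m (pi : nat -> 'End(N)),
  [/\ forall k x, pi k x \in G k, forall k x, x \in G k -> pi k x = x,
      forall j k x, j != k -> x \in G k -> pi j x = 0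
    & forall x, x = \sum_(k < m) pi k x].
Proof.
case=> _ [m [G0 dirG fullG]] _.
pose rho (i : 'I_m) : 'End(N) := sumv_pi_for (esym fullG) i.
(* Indices from [m] on get the zero projection, matching their zero components. *)
pose pi k : 'End(N) := if insub k is Some i then rho i else 0.
have piE (i : 'I_m) : pi i = rho i by rewrite /pi valK.
have piG k x : pi k x \in G k.
  rewrite /pi; case: insubP => [i _ <- | _]; first exact: memv_sum_pi.
  by rewrite lfunE mem0v.
have sum_pi x : x = \sum_(k < m) pi k x.
  rewrite -[LHS](sumv_pi_sum (esym fullG)) ?memvf //.
  by apply: eq_bigr => i _; rewrite piE.
have pi_delta k (x : N) : x \in G k ->
    forall j, pi j x = if j == k then x else 0.
  move=> xG j; have [ltjm | lemj] := ltnP j m; last first.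
    have := piG j x; rewrite G0 // memv0 => /eqP ->.
    by case: eqP => // jk; move: xG; rewrite -jk G0 // memv0 => /eqP.
  pose us (i : 'I_m) := pi i x.
  pose vs (i : 'I_m) := if i == k :> nat then x else 0.
  have usG i : xpredT i -> us i \in G i by move=> _; apply: piG.
  have vsG i : xpredT i -> vs i \in G i.
    by rewrite /vs; case: eqP => [->|_]; rewrite ?mem0v.
  have := elimT directv_sum_unique dirG us vs usG vsG.
  have -> : \sum_i us i == \sum_i vs i.
    rewrite -sum_pi /vs; have [ltkm | lemk] := ltnP k m.
      rewrite (bigD1 (Ordinal ltkm)) //= eqxx big1 ?addr0 // => i.
      by rewrite -val_eqE /= => /negPf ->.
    rewrite big1 => [|i _]; first by move: xG; rewrite G0 // memv0.
    by move: xG; rewrite G0 // memv0 => /eqP ->; case: eqP.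
  by move/esym/forall_inP/(_ (Ordinal ltjm) isT)/eqP.
exists m, pi; split=> // [k x xG | j k x jk xG].
  by rewrite (pi_delta k) // eqxx.
by rewrite (pi_delta k) // (negPf jk).
Qed.

Section HomogeneousPointing.
Variables (G : nat -> {vspace N}) (m : nat) (pi : nat -> 'End(N)).
Hypotheses (G0 : G 0%N = 0%VS).
Hypothesis GM :
  forall j k x y, x \in G j -> y \in G k -> amul x y \in G (j + k)%N.
Hypothesis piG : forall k x, pi k x \in G k.
Hypothesis pi_id : forall k x, x \in G k -> pi k x = x.
Hypothesis pi_0 : forall j k x, j != k -> x \in G k -> pi j x = 0.
Hypothesis sum_pi : forall x, x = \sum_(k < m) pi k x.

Let cN : commutative_alg N. Proof. by case: admN. Qed.
Let nilN : nilpotent_alg N. Proof. by case: admN. Qed.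

Lemma proj_mul k j x y : y \in G j -> pi (k + j)%N (amul x y) = amul (pi k x) y.
Proof.
move=> yG; rewrite {1}[x]sum_pi {2}[x]sum_pi amul_suml !linear_sum amul_suml.
apply: eq_bigr => i _; have [<- | ik] := eqVneq k i.
  by rewrite /= (pi_id (piG k x)) pi_id // GM // piG.
rewrite /= [pi k _](pi_0 ik) ?piG // amul0l (@pi_0 _ (i + j)%N) ?GM //.
by rewrite eqn_add2r.
Qed.

Lemma proj_annihilator k a : a \in annihilator N -> pi k a \in annihilator N.
Proof.
move=> aA; apply/annihilatorP => y; rewrite [y]sum_pi amul_sumr big1 // => i _.
by rewrite -(proj_mul _ _ (piG _ _)) mem_annihilator_amul ?linear0.
Qed.

Variables (d : nat) (w : {scalar N}) (a : N) (pw : pointed w a).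
Hypothesis aG : a \in G d.
Hypothesis w_proj : forall x, w x = w (pi d x).

(** Multiplication by positive degrees moves [x] above degree [d], where [w] vanishes, so [x] lies
    in the annihilator. *)
Lemma homogeneous_high k x : (d <= k)%N -> x \in G k -> x = w x *: a.
Proof.
move=> ledk xG; have [aA wa] := pw; apply.
apply: (form_nondegenerate admN pw) => z.
rewrite [z]sum_pi amul_sumr linear_sum big1 // => i _; rewrite w_proj.
have [i0 | i_gt0] := posnP i.
  have := piG i z; rewrite i0 G0 memv0 => /eqP ->.
  by rewrite amul0r !linear0.
rewrite (@pi_0 _ (k + i)%N) ?linear0 ?GM // neq_ltn; apply/orP; left.
by rewrite -[d]addn0 -addnS leq_add.
Qed.

Lemma homogeneous_vanish k x : (d < k)%N -> x \in G k -> x = 0.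
Proof.
move=> ltdk xG; rewrite (homogeneous_high (ltnW ltdk) xG) w_proj.
by rewrite (pi_0 _ xG) ?neq_ltn ?ltdk // linear0 scale0r.
Qed.

(* An automorphism, because [(1 - y) ^ j (1 - y) ^ k = (1 - y) ^ (j + k)]. *)
Definition graded_auto y : 'End(N) := (\sum_(k < m) (unit_mul y k \o pi k))%VF.

Lemma graded_auto_homogeneous y k x : x \in G k ->
  graded_auto y x = unit_mul y k x.
Proof.
move=> xG; rewrite sum_lfunE {2}[x]sum_pi linear_sum; apply: eq_bigr => i _.
rewrite comp_lfunE; have [-> // | ik] := eqVneq (i : nat) k.
by rewrite (pi_0 ik xG) !linear0.
Qed.

Lemma graded_autoM y x z :
  graded_auto y (amul x z) = amul (graded_auto y x) (graded_auto y z).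
Proof.
rewrite {1}[x]sum_pi {2}[x]sum_pi amul_suml !linear_sum amul_suml.
apply: eq_bigr => i _.
rewrite {1}[z]sum_pi {2}[z]sum_pi amul_sumr !linear_sum amul_sumr.
apply: eq_bigr => j _.
rewrite /= !(graded_auto_homogeneous _ (piG _ _)) unit_mulM //.
by rewrite (@graded_auto_homogeneous _ (i + j)%N) ?GM.
Qed.

(* The discrepancy between [w'] and [w] is removed degree by degree, from the
   top. *)
Lemma auto_transitive_pointings j (w' : {scalar N}) : w' a = 1 ->
    (forall k x, (j < k)%N -> x \in G k -> w' x = w x) ->
  exists f : 'End(N), (forall x y, f (amul x y) = amul (f x) (f y)) /\
    forall x, w' (f x) = w x.
Proof.
have [aA wa _] := pw.
elim: j w' => [|j IHj] w' w'a w'w.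
  exists \1%VF; split=> [x y | x]; rewrite !lfunE //=.
  rewrite [x]sum_pi !linear_sum; apply: eq_bigr => k _.
  have [k0 | k_gt0] := posnP k; last exact: (w'w k).
  by have := piG k x; rewrite k0 G0 memv0 => /eqP ->; rewrite !linear0.
(* From degree [d] on, everything is a multiple of [a], where both forms agree. *)
have [ledj | ltjd] := leqP d j.+1.
  apply: IHj => // k x.
  rewrite leq_eqVlt => /predU1P[<- | ltjk] xG; last exact: (w'w k).
  by rewrite (homogeneous_high ledj xG) !linearZ /= w'a wa.
have j0 : (j.+1%:R : F) != 0 := natf_neq0_pchar0 charF0 j.
(* The factor inverts the coefficient in [(1 - y)^(j+1) x = x - (j+1) y x]. *)
pose l x := j.+1%:R^-1 * (w' (pi j.+1 x) - w (pi j.+1 x)).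
have l_scalar : scalar l.
  by move=> c x y; rewrite /l !linearP /=; ring.
pose lF := GRing.isLinear.Build _ _ _ _ l l_scalar.
pose lS : {scalar N} := HB.pack l lF.
have [|y0 ly0] := form_riesz admN pw (l := lS).
  by rewrite /= /l (pi_0 _ aG) ?neq_ltn ?ltjd // !linear0 subr0 mulr0.
(* Only this component of [y0] pairs with degree [j.+1] under [w]; moreover [y y x] then exceeds
   degree [d] and vanishes. *)
pose e := (d - j.+1)%N; pose y := pi e y0.
have ej : (e + j.+1)%N = d by rewrite subnK // ltnW.
have e0 : (0 < e)%N by rewrite subn_gt0.
have yG : y \in G e by apply: piG.
have w'wy x : x \in G j.+1 -> w' x - w x = j.+1%:R * w (amul y x).
  move=> xG; rewrite /y -(proj_mul _ _ xG) ej -w_proj cN -ly0 /= /l pi_id //.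
  by rewrite mulrA mulfV ?mul1r.
have [||f [fM w'f]] := IHj (w' \o graded_auto y).
- have ya0 : amul y a = 0 by rewrite cN mem_annihilator_amul.
  rewrite /= (graded_auto_homogeneous _ aG) unit_mul_nil2 ya0 ?amul0r //.
  by rewrite scaler0 subr0.
- move=> k x; rewrite leq_eqVlt => /predU1P[<- | ltjk] xG /=.
    have yxG : amul y x \in G d by rewrite -ej GM.
    rewrite (graded_auto_homogeneous _ xG) unit_mul_nil2.
      rewrite linearB linearZ /= (w'w d (amul y x)) // -w'wy //; ring.
    apply: (@homogeneous_vanish (e + d)%N); rewrite ?GM //.
    by rewrite -[d in (d < _)%N]add0n ltn_add2r.
  have yx0 : amul y x = 0.
    by apply: (@homogeneous_vanish (e + k)%N); rewrite ?GM // -ej ltn_add2l.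
  rewrite (graded_auto_homogeneous _ xG) unit_mul_nil2 yx0 ?amul0r //.
  by rewrite scaler0 subr0 (w'w k).
exists (graded_auto y \o f)%VF; split=> [x z | x]; rewrite !comp_lfunE.
  by rewrite fM graded_autoM.
exact: w'f.
Qed.

(** An automorphism [f] carries the twist of [w] by [exp v] back to [w]; following it by the
    translation by [v] preserves the hypersurface and sends 0 to [v]. *)
Lemma graded_homogeneous v : w (expm1 v) = 0 ->
  exists f : 'End(N), bijective f /\
    forall z, w (expm1 z) = 0 <-> w (expm1 (f z + v)) = 0.
Proof.
move=> wv; have pt := pointed_twist admN (expm1 v) pw.
have [||f [fM wf]] := @auto_transitive_pointings d (twist w (expm1 v)).
- by case: pt.
- by move=> k x ltdk /(homogeneous_vanish ltdk) ->; rewrite !linear0.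
exists f; split=> [|z]; last by rewrite expm1_translate // -alg_hom_expm1 // wf.
apply: dim_eq_inj_bij => //; apply: raddf_inj => x fx0.
apply: (form_nondegenerate0 admN pw) => [z|]; rewrite -wf.
  by rewrite fM fx0 amul0l linear0.
by rewrite fx0 linear0.
Qed.

End HomogeneousPointing.
End Gradings.

(** * Affine isomorphisms and equivalence of graphs *)

Section AffineIsomorphisms.
Variable F : fieldType.
Implicit Types U V W : vectType F.
Local Open Scope classical_set_scope.

Lemma affine_iso_comp U V W (g : V -> W) (h : U -> V) :
  affine_iso g -> affine_iso h -> affine_iso (g \o h).
Proof.
case=> A [c [Abij gE]] [B [b [Bbij hE]]]; exists (A \o B)%VF, (A b + c).
split=> [|z]; first exact: bij_lfun_comp.
by rewrite /= hE gE linearD addrA comp_lfunE.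
Qed.

Lemma affine_iso_inv U V (g : U -> V) : affine_iso g ->
  exists h : V -> U, [/\ affine_iso h, cancel g h & cancel h g].
Proof.
case=> A [c [Abij gE]]; have [AK KA] := bij_lfunK Abij.
exists (fun z => A^-1%VF (z - c)); split=> [|z|z]; last 2 first.
- by rewrite gE addrK AK.
- by rewrite gE KA subrK.
exists A^-1%VF, (- A^-1%VF c); split; first exact: bij_lfun_inv.
by move=> z; rewrite linearB.
Qed.

Lemma affine_iso_lfun U V (f : 'Hom(U, V)) : bijective f -> affine_iso f.
Proof. by move=> f_bij; exists f, 0; split=> // z; rewrite addr0. Qed.

Lemma affine_iso_translate U V (f : 'Hom(U, V)) c :
  bijective f -> affine_iso (fun z => f z + c).
Proof. by move=> f_bij; exists f, c. Qed.

Lemma image_cancelP (T T' : Type) (g : T -> T') (h : T' -> T)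
    (S : set T) (S' : set T') :
  cancel g h -> cancel h g -> g @` S = S' <-> (forall z, S z <-> S' (g z)).
Proof.
move=> gK hK; split=> [<- z | SS'].
  split=> [Sz | [z' Sz' /(can_inj gK) <-] //]; by exists z.
apply/seteqP; split=> [_ [z /SS' Sz <-] // | z Sz].
by exists (h z); rewrite ?SS' hK.
Qed.

Lemma affine_image_iff U V (g : U -> V) (S : set U) (S' : set V) :
  affine_iso g -> g @` S = S' <-> (forall z, S z <-> S' (g z)).
Proof. by case/affine_iso_inv => h [_ gK hK]; apply: image_cancelP gK hK. Qed.

Lemma affinely_equivalentP W W' (p : W -> F) (p' : W' -> F) :
  affinely_equivalent p p' <->
  exists g, affine_iso g /\ forall z, graph p z <-> graph p' (g z).
Proof.
by split=> -[g [g_aff]] /affine_image_iff gS; exists g; split=> //; apply: gS.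
Qed.

Lemma linearly_affinely_equivalent W W' (p : W -> F) (p' : W' -> F) :
  linearly_equivalent p p' -> affinely_equivalent p p'.
Proof. by case=> f [/affine_iso_lfun f_aff fS]; exists f. Qed.

(* Homogeneity lets one compose an affine equivalence so that it fixes the
   origin. *)
Lemma homogeneous_linearly_equivalent W0 W W' (q : W0 -> F)
    (p : W -> F) (p' : W' -> F) :
  affinely_homogeneous (graph q) ->
  affinely_equivalent q p -> affinely_equivalent q p' ->
  p 0 = 0 -> p' 0 = 0 -> linearly_equivalent p p'.
Proof.
move=> q_hom /affinely_equivalentP[g [g_aff gS]].
move=> /affinely_equivalentP[g' [g'_aff g'S]] p0 p'0.
have [h [h_aff gK hK]] := affine_iso_inv g_aff.
have [h' [h'_aff g'K h'K]] := affine_iso_inv g'_aff.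
(* [k] joins the points of the graph of [q] that correspond to the two origins, so [g' \o k \o h]
   fixes 0 and is linear. *)
have [||k [k_aff /(affine_image_iff _ _ k_aff) kS k0]] := q_hom (h 0) (h' 0).
- by apply/gS; rewrite hK /graph /= p0.
- by apply/g'S; rewrite h'K /graph /= p'0.
have := affine_iso_comp g'_aff (affine_iso_comp k_aff h_aff).
case=> A [c [A_bij AE]].
have c0 : c = 0 by have := AE 0; rewrite /= k0 h'K linear0 add0r.
exists A; split=> //; apply/(affine_image_iff _ _ (affine_iso_lfun A_bij)) => z.
have -> : A z = g' (k (h z)) by rewrite [RHS]AE c0 addr0.
by rewrite -g'S -kS gS hK.
Qed.

End AffineIsomorphisms.

(** * The equivalences and Property (AH) *)

Section NilPolynomials.
Variables (F : fieldType) (charF0 : [pchar F] =i pred0).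
Local Open Scope classical_set_scope.

Lemma nil_polynomial0 (N : assocAlgebra F) (W : vectType F) (p : W -> F) :
  nil_polynomial N p -> p 0 = 0.
Proof.
by case=> omega [_ [phi [_ pE]]]; rewrite pE !linear0 exp2_0 linear0.
Qed.

Section TwoAlgebras.
Variables (N N' : assocAlgebra F) (admN : admissible N) (admN' : admissible N').
Variables (W W' : vectType F) (p : W -> F) (p' : W' -> F).
Hypotheses (Hp : nil_polynomial N p) (Hp' : nil_polynomial N' p').

Lemma isomorphic_affinely_equivalent :
  isomorphic_alg N N' -> affinely_equivalent p p'.
Proof.
have [w [a [chi [pw chi_bij chiP]]]] := nil_polynomial_chart charF0 admN Hp.
have [w' [a' [chi' [pw' chi'_bij chi'P]]]] :=
  nil_polynomial_chart charF0 admN' Hp'.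
case=> f [f_bij fM]; have [chi'K Kchi'] := bij_lfunK chi'_bij.
have [b fb] := alg_iso_affine charF0 admN admN' pw pw' f_bij fM.
apply/affinely_equivalentP.
exists (chi'^-1%VF \o ((fun z => f z + b) \o chi)); split; last first.
  by move=> z; rewrite chiP chi'P /= Kchi' fb.
apply: affine_iso_comp; first exact/affine_iso_lfun/bij_lfun_inv.
apply: affine_iso_comp; last exact: affine_iso_lfun.
exact: affine_iso_translate.
Qed.

Lemma affinely_equivalent_isomorphic :
  affinely_equivalent p p' -> isomorphic_alg N N'.
Proof.
have [w [a [chi [pw chi_bij chiP]]]] := nil_polynomial_chart charF0 admN Hp.
have [w' [a' [chi' [pw' chi'_bij chi'P]]]] :=
  nil_polynomial_chart charF0 admN' Hp'.
case/affinely_equivalentP => g [[A [c [A_bij gE]]] gS].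
have [chiK Kchi] := bij_lfunK chi_bij.
pose B := (chi' \o (A \o chi^-1))%VF; pose b := chi' c.
have BS z : w (expm1 z) = 0 -> w' (expm1 (B z + b)) = 0.
  rewrite -{1}[z]Kchi -chiP gS gE chi'P linearD.
  by rewrite /B !comp_lfunE.
(* 0 lies on the hypersurface of [w], so [b] lies on that of [w']; twisting [w'] by [exp b] absorbs
   the translation. *)
have wb : w' (expm1 b) = 0.
  rewrite -[b]add0r -(linear0 B); apply: BS.
  by rewrite expm1E exp2_0 addr0 linear0.
apply: (linear_graph_map_iso charF0 admN admN' pw
  (pointed_twist admN' (expm1 b) pw') (f := B)).
  by apply/bij_lfun_comp/bij_lfun_comp/bij_lfun_inv.
by move=> z /BS; rewrite expm1_translate.
Qed.

End TwoAlgebras.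

Lemma isomorphic_alg_refl (N : assocAlgebra F) : isomorphic_alg N N.
Proof.
exists \1%VF; split=> [|x y]; last by rewrite !lfunE.
by exists id => x; rewrite lfunE.
Qed.

Lemma grading_propertyAH (N : assocAlgebra F) (omega0 : 'Hom(N, F^o)) :
  admissible N -> pointing omega0 -> has_grading N -> propertyAH N.
Proof.
move=> admN /(pointing_pointed admN)[a0 [a0A w0a0 _]] [G grG].
have [G0 _ GM] := grG.
have [m [pi [piG pi_id pi_0 sum_pi]]] := grading_projections grG.
(* Some component of [a0] has nonzero value; composing with its projection gives a homogeneous
   pointing. *)
have [/existsP[/= d w0d] | /existsPn/= w00] :=
    boolP [exists k : 'I_m, lform omega0 (pi k a0) != 0]; last first.
  move/eqP: w0a0; rewrite [a0]sum_pi linear_sum big1 ?(eq_sym 0) ?oner_eq0 //.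
  by move=> k _; apply/eqP/negPn/w00.
pose a := (lform omega0 (pi d a0))^-1 *: pi d a0.
pose omega : 'Hom(N, F^o) := (omega0 \o pi d)%VF.
have omegaE x : lform omega x = lform omega0 (pi d x).
  by rewrite /lform comp_lfunE.
have aG : a \in G d by rewrite memvZ.
have aA : a \in annihilator N.
  by rewrite memvZ // (proj_annihilator GM piG pi_id pi_0 sum_pi).
have pw : pointed (lform omega) a.
  apply: pointed_of_neq0 => //=.
  by rewrite omegaE /a !linearZ /= (pi_id _ _ (piG d a0)) mulVf.
have w_proj x : lform omega x = lform omega (pi d x).
  by rewrite !omegaE (pi_id _ _ (piG d x)).
have id_bij : bijective (\1%VF : 'End(subvs_of (lker omega))).
  by exists id => x; rewrite lfunE.
pose p (x : subvs_of (lker omega)) : F := omega (exp2 (vsval x)).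
have pE x :
    p x = omega (exp2 (vsval ((\1%VF : 'End(subvs_of (lker omega))) x))).
  by rewrite id_lfunE.
exists (subvs_of (lker omega)), p; split.
  by exists omega; split; [apply: pointed_pointing pw | exists \1%VF].
have [chi [chi_bij chiP]] := graph_chart charF0 admN pw id_bij pE.
have [chiK Kchi] := bij_lfunK chi_bij.
(* For transitivity it suffices to reach every point from the origin. *)
have move0 v : graph p v -> exists h,
    [/\ affine_iso h, forall z, graph p z <-> graph p (h z) & h 0 = v].
  move=> /chiP wv.
  have [f [f_bij fS]] := graded_homogeneous charF0 admN G0 GM piG pi_id pi_0
    sum_pi pw aG w_proj wv.
  exists (chi^-1%VF \o ((fun z => f z + chi v) \o chi)); split.
  - apply: affine_iso_comp; first exact/affine_iso_lfun/bij_lfun_inv.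
    apply: affine_iso_comp; last exact: affine_iso_lfun.
    exact: affine_iso_translate.
  - by move=> z; rewrite !chiP /= Kchi fS.
  by rewrite /= !linear0 add0r chiK.
move=> u v /move0[g [g_aff gS gu]] /move0[h [h_aff hS hv]].
have [g' [g'_aff gK g'K]] := affine_iso_inv g_aff.
have hg'_aff := affine_iso_comp h_aff g'_aff.
exists (h \o g'); split=> //; last by rewrite /= -gu gK.
by apply/(affine_image_iff _ _ hg'_aff) => z; rewrite /= -hS gS g'K.
Qed.

End NilPolynomials.

Theorem mainTheorem15 (F : fieldType) (charF0 : [pchar F] =i pred0)
    (N N' : assocAlgebra F) (admN : admissible N) (admN' : admissible N')
    (W W' : vectType F) (p : W -> F) (p' : W' -> F)
    (Hp : nil_polynomial N p) (Hp' : nil_polynomial N' p') :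
  [/\ isomorphic_alg N N' <-> affinely_equivalent p p',
      propertyAH N -> (isomorphic_alg N N' <-> linearly_equivalent p p')
    & has_grading N -> propertyAH N].
Proof.
have aff_iso := affinely_equivalent_isomorphic charF0 admN admN' Hp Hp'.
split.
- split=> //; exact: (isomorphic_affinely_equivalent charF0 admN admN' Hp Hp').
(* The homogeneous graph may belong to another nil-polynomial [q] of [N]; both [p] and [p'] are
   affinely equivalent to it. *)
- case=> W0 [q [Hq q_hom]]; split=> [isoNN' | /linearly_affinely_equivalent //].
  apply: (homogeneous_linearly_equivalent q_hom).
  + apply: (isomorphic_affinely_equivalent charF0 admN admN Hq Hp).
    exact: isomorphic_alg_refl.
  + exact: (isomorphic_affinely_equivalent charF0 admN admN' Hq Hp').
  + exact: nil_polynomial0 Hp.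
  + exact: nil_polynomial0 Hp'.
by case: Hp => omega [pt _]; apply: (grading_propertyAH charF0 admN pt).
Qed.
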